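(* Let $n\ge 2$ and let $X_1,\dots,X_n$ be real-valued (possibly dependent) random variables with order statistics $X_{1:n}\le\cdots\le X_{n:n}$. Suppose one of the following holds: (A) the distribution function of $X_{n:n}$ has infinite upper endpoint, $X_{n:n}\in\mathrm{GMDA}(h)$ for some positive function $h$, and $$\lim_{x\to\infty}\frac{\mathbb{P}(|X_i|>t h(x),X_j>x)}{\mathbb{P}(X_{n:n}>x)}=0\ \text{for all }1\le i\ne j\le n\text{ and all }t>0,\qquad(\ast)$$ $$\lim_{x\to\infty}\frac{\mathbb{P}(X_i>Lh(x),X_j>Lh(x))}{\mathbb{P}(X_{n:n}>x)}=0\ \text{for all }1\le i<j\le n\text{ and some }L>0;\qquad(\ast\ast)$$ (B) $X_{n:n}\in\mathcal{L}$ and there exists $h\in\mathcal{H}_{X_{n:n}}$ such that $(\ast)$ and $(\ast\ast)$ hold; (C) $X_{n:n}\in\mathcal{L}\cap\mathcal{D}$ and there exists a dominatedly varying $h\in\mathcal{H}_{X_{n:n}}$ such that $(\ast)$ holds. Then for any $0<a\le b<\infty$ and $0\le d<\infty$, $$\mathbb{P}\Big(\sum_{i=0}^{n-1}c_iX_{n-i:n}>x\Big)\sim\mathbb{P}(c_0X_{n:n}>x)\sim\sum_{i=1}^n\mathbb{P}(c_0X_i>x),\qquad x\to\infty,$$ uniformly for $(c_0,c_1,\dots,c_{n-1})\in[a,b]\times[0,d]^{n-1}$ (i.e. the suprema over this set of the absolute differences of the ratios of any two of these quantities from $1$ tend to $0$).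
   Context: Real-valued random variables are assumed not to be concentrated on $(-\infty,0]$. For a distribution function $F$, $\overline{F}=1-F$ and $x_F=\sup\{x:F(x)<1\}$. $F\in\mathrm{GMDA}(h)$ (Gumbel max-domain of attraction) means $\lim_{x\to x_F}\overline{F}(x+yh(x))/\overline{F}(x)=e^{-y}$ for all $y\in\mathbb{R}$. $F\in\mathcal{L}$ (long-tailed) means $\overline{F}(x)>0$ for all $x\ge0$ and $\overline{F}(x+y)\sim\overline{F}(x)$ for every $y\in\mathbb{R}$. $F\in\mathcal{D}$ means $\overline{F}$ is dominatedly varying. A positive function $g$ is dominatedly varying if $0<\liminf_{x\to\infty}g(xy)/g(x)\le\limsup_{x\to\infty}g(xy)/g(x)<\infty$ for every $y>0$. For $F\in\mathcal{L}$, $\mathcal{H}_F$ is the set of eventually positive $h$ with (i) $h(x)=o(x)$; (ii) $\overline{F}(x+yh(x))\sim\overline{F}(x)$ for all $y\in\mathbb{R}$; (iii) $\limsup_{x\to\infty}h(x+yh(x))/h(x)<\infty$ for all $y\in\mathbb{R}$. A random variable is said to belong to a class if its distribution function does. $a(x)\sim b(x)$ means $a(x)/b(x)\to1$ as $x\to\infty$. *)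

(* Defs.v *)
From HB Require Import structures.
From mathcomp Require Import all_boot all_order all_algebra.
From mathcomp Require Import all_classical all_reals all_analysis.
Set Implicit Arguments. Unset Strict Implicit. Unset Printing Implicit Defensive.
Import Order.TTheory GRing.Theory Num.Theory.
Import numFieldNormedType.Exports.
Local Open Scope classical_set_scope.
Local Open Scope ring_scope.

Section Defs.
Context (R : realType) (d : measure_display) (T : measurableType d)
  (P : probability T R).

Definition prob (A : set T) : R := fine (P A).

(* order statistics, 1-based: ostat X k w = X_{k:n}(w), with
   X_{1:n} <= ... <= X_{n:n} *)
Definition ostat (n : nat) (X : 'I_n -> T -> R) (k : nat) (w : T) : R :=
  nth 0 (sort <=%R [seq X i w | i <- enum 'I_n]) (k - 1).

Definition tailF (Y : T -> R) (x : R) : R := prob [set w | x < Y w].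
End Defs.

Section Classes.
Context (R : realType).

Definition GMDA_inf (Fbar : R -> R) (h : R -> R) : Prop :=
  (forall x, 0 < Fbar x) /\
  forall y : R, (fun x => Fbar (x + y * h x) / Fbar x) @ +oo --> expR (- y).

Definition long_tailed (Fbar : R -> R) : Prop :=
  (forall x, 0 <= x -> 0 < Fbar x) /\
  forall y : R, (fun x => Fbar (x + y) / Fbar x) @ +oo --> (1:R).

(* dominated variation of a positive function g:
   0 < liminf g(xy)/g(x) <= limsup g(xy)/g(x) < oo for every y > 0,
   i.e. the ratio is eventually bounded below by some c > 0 and above
   by some C < oo *)
Definition dom_varying (g : R -> R) : Prop :=
  forall y : R, 0 < y ->
    exists c C : R, 0 < c /\
      \forall x \near +oo, c <= g (x * y) / g x <= C.

Definition HF (Fbar : R -> R) (h : R -> R) : Prop :=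
  (\forall x \near +oo, 0 < h x) /\
  (fun x => h x / x) @ +oo --> (0:R) /\
  (forall y : R, (fun x => Fbar (x + y * h x) / Fbar x) @ +oo --> (1:R)) /\
  (forall y : R, exists C : R, \forall x \near +oo, h (x + y * h x) / h x <= C).
End Classes.

(* Main.v *)
Require Import Defs.
From HB Require Import structures.
From mathcomp Require Import all_boot all_order all_algebra all_fingroup.
From mathcomp Require Import zify lra.
From mathcomp Require Import all_classical all_reals all_analysis measurable_realfun.
Import Order.TTheory GRing.Theory Num.Theory.
Import numFieldNormedType.Exports.
Local Open Scope classical_set_scope.
Local Open Scope ring_scope.

(** After division by [c_0] everything takes place at the level [y = x / c_0],
    with [c_0 = 1] and the other weights in [[0, dd / a]]; write [M] for the
    maximum and [F] for its tail.  If all the non-maximal [X_i] are at most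
    [t h(y)] in absolute value, the weighted sum differs from [M] by at most
    [K t h(y)], and [F (y +- K t h(y)) / F y] is close to [1] for small [t].
    Otherwise some non-maximal [X_i] is large while [X_j + K X_i > y] for the
    maximal [X_j], and this event is negligible with respect to [F y].
    Under ( ** ) one may assume [X_i <= L h(y)], so that [X_j > y - K L h(y)],
    and then ( * ) applies at the level [y - K L h(y)], because [F] and [h]
    change there by bounded factors only.  In case (C), [X_j > y / (1 + K)] and
    dominated variation allows to apply ( * ) at [y / (1 + K)].  The comparison
    of [F] with the sum of the marginal tails is Bonferroni's inequality, since
    [h(y) <= y] eventually. *)

(** * Union bounds and a Bonferroni inequality for real-valued probabilities *)

Section Prob.
Context {R : realType} {d : measure_display} {T : measurableType d}
  (P : probability T R).
Implicit Types A B : set T.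

Lemma prob_ge0 A : 0 <= prob P A.
Proof. exact: fine_ge0. Qed.

Lemma prob_le A B : measurable A -> measurable B -> A `<=` B ->
  prob P A <= prob P B.
Proof.
by move=> mA mB AB; apply: fine_le; rewrite ?fin_num_measure//;
  apply: le_measure; rewrite ?inE.
Qed.

Lemma prob_setU A B : measurable A -> measurable B ->
  prob P (A `|` B) <= prob P A + prob P B.
Proof.
move=> mA mB; rewrite /prob -fineD ?fin_num_measure//.
apply: fine_le; rewrite ?fin_numD ?fin_num_measure//; last exact: measureU2.
exact: measurableU.
Qed.

Lemma prob_setUI A B : measurable A -> measurable B ->
  prob P A + prob P B = prob P (A `|` B) + prob P (A `&` B).
Proof.
move=> mA mB; rewrite /prob.
have mI := measurableI _ _ mA mB; have mD := measurableD mB mA.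
have -> : A `|` B = A `|` (B `\` A) 
  by apply/seteqP; split=> w /=; have [?|?] := pselect (A w); tauto.
rewrite measureU//; last by rewrite setDE setIC -setIA [~` A `&` A]setIC setICr setI0.
rewrite (measureDI _ mB mA) [B `&` A]setIC.
by rewrite -!fineD ?fin_numD ?fin_num_measure//= addeA.
Qed.

Lemma prob_bigsetU (I : Type) (s : seq I) (Q : pred I) (A : I -> set T) :
  (forall i, measurable (A i)) ->
  prob P (\big[setU/set0]_(i <- s | Q i) A i) <= \sum_(i <- s | Q i) prob P (A i).
Proof.
move=> mA; elim: s => [|i s IHs]; first by rewrite !big_nil /prob measure0.
rewrite !big_cons; case: (Q i) => //.
apply: (le_trans (prob_setU _ _ _ _)) => //; last by rewrite lerD2l.
exact: bigsetU_measurable.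
Qed.

(** Bonferroni with a coarse constant. A new event meets the union of the others with probability at
    most [size s * e], and the quadratic factor absorbs this because [s + s ^ 2 <= (s + 1) ^ 2]. *)
Lemma prob_sum_le (I : eqType) (s : seq I) (A : I -> set T) (e : R) :
  uniq s -> (forall i, measurable (A i)) ->
  (forall i j, i != j -> prob P (A i `&` A j) <= e) -> 0 <= e ->
  \sum_(i <- s) prob P (A i)
    <= prob P (\big[setU/set0]_(i <- s) A i) + (size s ^ 2)%:R * e.
Proof.
move=> us mA Ae e0; elim: s us => [_|i s IHs /= /andP[si us]].
  by rewrite !big_nil mul0r addr0 prob_ge0.
rewrite !big_cons.
set U := \big[_/_]_(_ <- _) _ in IHs *.
have mU : measurable U by exact: bigsetU_measurable.
have inter : prob P (A i `&` U) <= (size s)%:R * e.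
  rewrite /U big_distrr/=.
  apply: (le_trans (prob_bigsetU _ _ _ _ _)) => [j|]; first exact: measurableI.
  rewrite big_seq (le_trans (y := \sum_(j <- s | j \in s) e))//.
    by apply: ler_sum => j sj; apply: Ae; apply: contraNneq si => ->.
  by rewrite -big_seq big_const_seq iter_addr addr0 count_predT mulr_natl.
have := IHs us; have := prob_setUI _ _ (mA i) mU.
have : (size s)%:R * e + (size s ^ 2)%:R * e <= ((size s).+1 ^ 2)%:R * e.
  by rewrite -mulrDl -natrD ler_wpM2r// ler_nat; nia.
lra.
Qed.

End Prob.

Lemma measurable_set_bool {d : measure_display} {T : measurableType d}
    (b : T -> bool) :
  measurable_fun setT b -> measurable [set w | b w].
Proof. by move=> mb; rewrite -preimage_true -[X in measurable X]setTI; exact: mb. Qed.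

(** * Order statistics: measurability and pointwise rearrangement *)

Section OrderStatistics.
Context {R : realType} {d : measure_display} {T : measurableType d}.
Context {n : nat} (X : 'I_n -> T -> R).

Lemma ostat_perm (w : T) : exists p : 'S_n,
  (forall k : 'I_n, ostat X k.+1 w = X (p k) w) /\
  (forall k l : 'I_n, (k <= l)%N -> X (p k) w <= X (p l) w).
Proof.
set t := [tuple X i w | i < n].
have /tuple_permP[p sE] : perm_eq (sort <=%R t) t by rewrite perm_sort.
have pE (k : 'I_n) : ostat X k.+1 w = X (p k) w.
  rewrite /ostat subn1 /=.
  have -> : [seq X i w | i <- enum 'I_n] = t by [].
  by rewrite sE -tnth_nth !tnth_mktuple.
exists p; split=> // k l kl; rewrite -!pE /ostat !subn1 /=.
apply: le_sorted_leq_nth => //;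
  rewrite ?inE ?size_sort ?size_map -?enumT ?size_enum_ord//.
exact: sort_le_sorted.
Qed.

(** The [k]-th smallest value exceeds [x] exactly when at most [k - 1] of the values are [<= x].
    This count is a finite sum of indicators, and the rays []x, +oo[] generate the Borel sets. *)
Lemma measurable_ostat k : (0 < k <= n)%N -> (forall i, measurable_fun setT (X i)) ->
  measurable_fun setT (ostat X k).
Proof.
move=> /andP[k0 kn] mX.
apply: (measurability _ (RGenOInfty.measurableE R)) => _ [_ [x ->] <-].
rewrite setTI.
have -> : ostat X k @^-1` `]x, +oo[%classic =
    [set w | \sum_(i <- enum 'I_n) (X i w <= x)%R%:R <= (k - 1)%:R :> R].
  have cE w : (\sum_(i <- enum 'I_n) (X i w <= x)%R)%N
      = count (<= x) (sort <=%R [seq X i w | i <- enum 'I_n]).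
    rewrite count_sort count_map -sum1_count [RHS]big_mkcond/=.
    by apply: eq_bigr => i _; case: (X i w <= x).
  have ss w := sort_le_sorted [seq X i w | i <- enum 'I_n].
  apply/seteqP; split=> w /=; rewrite in_itv/= andbT /ostat -natr_sum ler_nat cE.
  - by rewrite leqNgt ltNge; apply: contraNN; exact: nth_count_le.
  - move=> ck; apply: nth_count_gt => //.
    by rewrite ck size_sort size_map size_enum_ord subn1 prednK.
apply: measurable_set_bool; apply: measurable_fun_ler => //.
apply: (@measurable_sum _ _ _ _ _ _ (fun i w => (X i w <= x)%R%:R)) => i.
have mb : measurable_fun setT (fun w => X i w <= x) by exact: measurable_fun_ler.
exact: (measurableT_comp (f := fun b : bool => b%:R : R) _ mb).
Qed.

End OrderStatistics.

(** Reindexing by the sorting permutation at [w] attaches the weights to the [X i] themselves, and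
    separates the maximum, with weight [v 0], from the other terms. Both [j] and [u] depend on [w],
    but the bound [D] does not. *)
Lemma weighted_ostat_sum {R : realType} {d : measure_display}
    {T : measurableType d} {n : nat} (X : 'I_n -> T -> R) (D : R)
    (v : nat -> R) (w : T) :
  (0 < n)%N ->
  (forall i, (1 <= i < n)%N -> 0 <= v i <= D) ->
  exists (j : 'I_n) (u : 'I_n -> R),
    [/\ ostat X n w = X j w, forall i, X i w <= X j w,
        forall i, i != j -> 0 <= u i <= D &
        \sum_(i < n) v i * ostat X (n - i) w
          = v 0%N * X j w + \sum_(i | i != j) u i * X i w].
Proof.
move=> n0 vD; have [p [oE pmono]] := ostat_perm X w.
case: n n0 X vD p oE pmono => // m _ X vD p oE pmono.
(* [r k] is the rank of [X k w] counted from the top, starting at 0, since [v i] multiplies the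
   order statistic of index [n - i]. Rank 0 belongs to [p ord_max]. *)
pose r k : 'I_m.+1 := rev_ord ((p^-1)%g k).
have rM k : (r k == ord0) = (k == p ord_max).
  rewrite /r (can2_eq rev_ordK rev_ordK) (can2_eq (permKV p) (permK p)).
  by congr (_ == p _); apply/val_inj; rewrite /= subn1.
exists (p ord_max), (fun k => v (r k)); split.
- by rewrite -oE.
- by move=> i; rewrite -[i](permKV p); apply: pmono; rewrite -ltnS.
- move=> i; rewrite -rM => ri; apply: vD; rewrite ltn_ord andbT lt0n.
  exact: ri.
- have r0 : r (p ord_max) = ord0 by apply/eqP; rewrite rM.
  rewrite (_ : v 0%N = v (r (p ord_max))); last by rewrite r0.
  rewrite (bigD1 (r (p ord_max)))//= [in LHS](reindex r)/=; last first.
    exists (fun k => p (rev_ord k)) => k _; rewrite /r.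
      by rewrite rev_ordK permKV.
    by rewrite permK rev_ordK.
  have tE k : ostat X (m.+1 - r k) w = X k w.
    rewrite -{2}[k](permKV p) -oE; congr ostat.
    by rewrite /r /= subSS subSn ?leq_subr// subKn // -ltnS.
  rewrite tE; congr (_ + _); apply: eq_big => k; last by rewrite tE.
  by rewrite r0 rM.
Qed.

Lemma ostat_max {R : realType} {d : measure_display} {T : measurableType d}
    {n : nat} (X : 'I_n -> T -> R) (w : T) : (0 < n)%N ->
  exists j, ostat X n w = X j w /\ forall i, X i w <= X j w.
Proof.
move=> n0; have [i _|j [u [? ? _ _]]] := weighted_ostat_sum X 0 (fun=> 0) w n0.
  by rewrite lexx.
by exists j.
Qed.

Lemma measurable_set_lt {d : measure_display} {T : measurableType d}
    {R : realType} (f g : T -> R) :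
  measurable_fun setT f -> measurable_fun setT g ->
  measurable [set w | f w < g w].
Proof. by move=> mf mg; apply: measurable_set_bool; exact: measurable_fun_ltr. Qed.

Lemma measurable_set_le {d : measure_display} {T : measurableType d}
    {R : realType} (f g : T -> R) :
  measurable_fun setT f -> measurable_fun setT g ->
  measurable [set w | f w <= g w].
Proof. by move=> mf mg; apply: measurable_set_bool; exact: measurable_fun_ler. Qed.

(** * Tails and quotients of tails at infinity *)

Section Tail.
Context {R : realType} {d : measure_display} {T : measurableType d}
  (P : probability T R) (Y : T -> R).
Hypothesis mY : measurable_fun setT Y.

Lemma tailF_nonincreasing (x y : R) : x <= y -> tailF P Y y <= tailF P Y x.
Proof.
move=> xy; apply: prob_le; try exact: measurable_set_lt.
by move=> w /=; exact: le_lt_trans.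
Qed.

Lemma tailF_near0 (e : R) : 0 < e -> \forall x \near +oo, tailF P Y x <= e.
Proof.
move=> e0.
pose Z : {RV P >-> R} := HB.pack Y (isMeasurableFun.Build _ _ _ _ Y mY).
have Z0 : (fun x => fine (ccdf Z x)) x @[x --> +oo] --> (0 : R).
  by apply: fine_cvg; exact: cvg_ccdfy0.
have -> : tailF P Y = fun x => fine (ccdf Z x).
  apply/funext => x; rewrite /tailF /prob /ccdf /distribution /pushforward.
  congr (fine (P _)); apply/seteqP; split => w /=; by rewrite in_itv/= andbT.
exact: cvgr_le Z0 _ e0.
Qed.

End Tail.

Section Ratio.
Context {R : realType}.
Variables (f F : R -> R) (l c : R).
Hypotheses (F_gt0 : forall x, 0 < F x) (fFl : (fun x => f x / F x) @ +oo --> l).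

Lemma near_ratio_le : l < c -> \forall x \near +oo, f x <= c * F x.
Proof.
move=> lc; near=> x.
by rewrite -ler_pdivrMr//; near: x; exact: cvgr_le fFl _ lc.
Unshelve. all: by end_near. Qed.

Lemma near_ratio_ge : c < l -> \forall x \near +oo, c * F x <= f x.
Proof.
move=> lc; near=> x.
by rewrite -ler_pdivlMr//; near: x; exact: cvgr_ge fFl _ lc.
Unshelve. all: by end_near. Qed.

End Ratio.

(** * Behaviour of the tail and of the scale [h] at shifted points *)

Section Scale.
Context {R : realType}.
Variables F h : R -> R.
Hypotheses (F_gt0 : forall x, 0 < F x)
  (F_nonincr : forall x y, x <= y -> F y <= F x)
  (F_near0 : forall e : R, 0 < e -> \forall x \near +oo, F x <= e).

(* [F (x + u h x)] is of the order of [F x], hence tends to [0], and [F]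
   stays away from [0] on sets bounded above. *)
Lemma shift_cvgy (u C : R) :
  (\forall x \near +oo, F (x + u * h x) <= C * F x) ->
  x + u * h x @[x --> +oo] --> +oo.
Proof.
move=> FC; apply/cvgryPge => A; near=> x.
rewrite leNgt; apply/negP => xA.
have FA := F_nonincr _ _ (ltW xA).
have : F (x + u * h x) <= C * F x by near: x.
have : F x <= F A / (2 * (`|C| + 1)).
  by near: x; apply: F_near0; rewrite divr_gt0// mulr_gt0// ltr_wpDl.
rewrite ler_pdivlMr ?mulr_gt0 ?ltr_wpDl//.
have := F_gt0 x; have := F_gt0 A; have := ler_norm C; nra.
Unshelve. all: by end_near. Qed.

(* If [x' = x + u h(x)] and [h x' > 2 h x], then [x' + h x' > x + (u + 2) h x];
   comparing the limits of [F] at these points gives [exp (-u - 1) <=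
   exp (-u - 2)] up to a factor close to [1]. *)
Lemma GMDA_scale_le (u : R) : (forall x, 0 < h x) -> GMDA_inf F h ->
  \forall x \near +oo, h (x + u * h x) <= 2 * h x.
Proof.
move=> h_gt0 [_ FE].
(* Relative errors of 1/8 are small enough: the final contradiction opposes
   [49/64 <= 9/8 * expR (- 1)] to [expR (- 1) <= 1/2]. *)
have e1 (v : R) : expR (- v) * (7 / 8) < expR (- v).
  by rewrite gtr_pMr ?expR_gt0//; lra.
have e2 (v : R) : expR (- v) < expR (- v) * (9 / 8).
  by rewrite ltr_pMr ?expR_gt0//; lra.
have xy : x + u * h x @[x --> +oo] --> +oo.
  exact: shift_cvgy (near_ratio_le _ _ _ _ F_gt0 (FE u) (e2 u)).
near=> x; rewrite leNgt; apply/negP => hx.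
have le1 : expR (- 1) * (7 / 8) * F (x + u * h x)
    <= F (x + u * h x + 1 * h (x + u * h x)).
  by near: x; exact: xy (near_ratio_ge _ _ _ _ F_gt0 (FE 1) (e1 1)).
have le2 : expR (- u) * (7 / 8) * F x <= F (x + u * h x).
  by near: x; exact: near_ratio_ge _ _ _ _ F_gt0 (FE u) (e1 u).
have le3 : F (x + (u + 2) * h x) <= expR (- (u + 2)) * (9 / 8) * F x.
  by near: x; exact: near_ratio_le _ _ _ _ F_gt0 (FE (u + 2)) (e2 (u + 2)).
set x' := x + u * h x in hx le1 le2 *.
have le4 : F (x' + 1 * h x') <= F (x + (u + 2) * h x).
  by apply: F_nonincr; rewrite /x'; nra.
have : expR (- 1) * (7 / 8) * (expR (- u) * (7 / 8) * F x)
    <= expR (- (u + 2)) * (9 / 8) * F x.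
  apply: le_trans le3; apply: le_trans le4; apply: le_trans le1.
  by rewrite ler_wpM2l// mulr_ge0 ?expR_ge0//; lra.
have -> : - (u + 2) = - u + (- 1 + - 1) by lra.
rewrite !expRD; set a := expR (- 1); set b := expR (- u).
have a0 : 0 < a by exact: expR_gt0.
have b0 : 0 < b by exact: expR_gt0.
have a2 : a <= 1 / 2.
  rewrite /a expRN div1r lef_pV2 ?posrE ?expR_gt0//.
  by have := expR_ge1Dx (1 : R); lra.
have abF : 0 < a * b * F x by rewrite !mulr_gt0.
nra.
Unshelve. all: by end_near. Qed.

End Scale.

(** * Comparison of the weighted sum, the maximum and the marginal tails at one level *)

Lemma weighted_sum_le {R : realType} {n : nat} (j : 'I_n) (u z : 'I_n -> R)
    (D r : R) :
  0 <= D -> 0 <= r -> (forall i, i != j -> 0 <= u i <= D) ->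
  (forall i, i != j -> z i <= r) ->
  \sum_(i | i != j) u i * z i <= n%:R * D * r.
Proof.
move=> D0 r0 uD zr; rewrite (le_trans (y := \sum_(i < n) D * r))//.
  rewrite big_mkcond/=; apply: ler_sum => i _.
  have [_|ij] := eqVneq i j; first exact: mulr_ge0.
  have /andP[ui0 uiD] := uD i ij.
  by rewrite (le_trans (ler_wpM2l ui0 (zr i ij)))// ler_wpM2r.
by rewrite sumr_const card_ord -mulrA mulr_natl.
Qed.

Section Core.
Context {R : realType} {d : measure_display} {T : measurableType d}
  (P : probability T R) {n : nat} (X : 'I_n -> T -> R) (h : R -> R).
Hypotheses (n_gt0 : (0 < n)%N) (mX : forall i, measurable_fun setT (X i)).
Local Notation F := (tailF P (ostat X n)).
Hypotheses (F_gt0 : forall x, 0 < F x)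
  (h_gt0 : \forall x \near +oo, 0 < h x).

(** Little-o for probabilities, in product form so that finitely many such bounds can be added. *)
Definition negligible_wrt (g : R -> R) (A : R -> set T) : Prop :=
  forall e : R, 0 < e -> \forall x \near +oo, prob P (A x) <= e * g x.

Let mM : measurable_fun setT (ostat X n).
Proof. by apply: measurable_ostat => //; rewrite n_gt0 leqnn. Qed.

Lemma exists_pair_bigcup (A : 'I_n -> 'I_n -> set T) :
  [set w | exists i j, i != j /\ A i j w]
    = \big[setU/set0]_(p : 'I_n * 'I_n | p.1 != p.2) A p.1 p.2.
Proof.
rewrite -bigcup_seq_cond; apply/seteqP; split => w /=.
  by move=> [i [j [ij Aij]]]; exists (i, j) => //=; rewrite mem_index_enum.
by move=> [[i j] /= /andP[_ ij] Aij]; exists i, j.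
Qed.

Lemma measurable_exists_pair (A : 'I_n -> 'I_n -> set T) :
  (forall i j, measurable (A i j)) ->
  measurable [set w | exists i j, i != j /\ A i j w].
Proof.
move=> mA; rewrite exists_pair_bigcup; exact: bigsetU_measurable.
Qed.

(** Union bound over at most [n * n] pairs, each with the share [e / (n * n)]; finitely many pairs
    admit a common threshold. *)
Lemma negligible_exists_pair (A : 'I_n -> 'I_n -> R -> set T) :
  (forall i j x, measurable (A i j x)) ->
  (forall i j, i != j -> negligible_wrt F (A i j)) ->
  negligible_wrt F (fun x => [set w | exists i j, i != j /\ A i j x w]).
Proof.
move=> mA nA e e0.
have nn0 : 0 < (n * n)%:R :> R by rewrite ltr0n muln_gt0 n_gt0.
have : \forall x \near +oo, forall p : 'I_n * 'I_n, p.1 != p.2 ->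
    prob P (A p.1 p.2 x) <= e / (n * n)%:R * F x.
  apply: filter_forall => -[i j] /=; have [->|ij] := eqVneq i j.
    by near=> x.
  by apply: filterS (nA i j ij _ (divr_gt0 e0 nn0)) => x.
apply: filterS => x Ax; rewrite exists_pair_bigcup.
apply: (le_trans (prob_bigsetU _ _ _ _ _ _)) => //.
apply: (le_trans (ler_sum _ Ax)).
rewrite sumr_const; set N := #|_|; rewrite -[_ *+ N]mulr_natr.
have : (N <= n * n)%N by rewrite (leq_trans (max_card _))// card_prod !card_ord.
rewrite -(ler_nat R) => cn.
apply: (le_trans (ler_wpM2l _ cn)).
  by rewrite mulr_ge0 ?ltW// divr_gt0.
by rewrite mulrAC divfK ?gt_eqF.
Unshelve. all: by end_near. Qed.

Hypotheses (h_le : \forall x \near +oo, h x <= x)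
  (F_shift : forall e : R, 0 < e -> exists2 t : R, 0 < t &
    \forall x \near +oo, F (x - t * h x) <= (1 + e) * F x /\
                         (1 - e) * F x <= F (x + t * h x))
  (joint : forall i j, i != j -> forall t : R, 0 < t ->
    negligible_wrt F (fun x => [set w | t * h x < `|X i w| /\ x < X j w]))
  (two_large : forall i j, i != j -> forall K t : R, 0 <= K -> 0 < t ->
    negligible_wrt F (fun x =>
      [set w | t * h x < X i w /\ X i w <= X j w /\ x < X j w + K * X i w])).

Lemma F_shift_scaled (K e : R) : 0 <= K -> 0 < e -> exists2 t : R, 0 < t &
  \forall x \near +oo, F (x - K * (t * h x)) <= (1 + e) * F x /\
                       (1 - e) * F x <= F (x + K * (t * h x)).
Proof.
move=> K0 e0; have [t t0 ht] := F_shift e e0.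
have K1 : 0 < K + 1 by rewrite ltr_wpDl.
(* Dividing by [K + 1] rather than [K] covers [K = 0]. *)
exists (t / (K + 1)); first exact: divr_gt0.
near=> x.
have hx : 0 < h x by near: x.
have Kt : K * (t / (K + 1) * h x) <= t * h x.
  rewrite !mulrA ler_wpM2r ?(ltW hx)// ler_pdivrMr//; nra.
have [F1 F2] : F (x - t * h x) <= (1 + e) * F x /\
    (1 - e) * F x <= F (x + t * h x) by near: x.
split; [apply: le_trans F1 | apply: (le_trans F2)];
  by apply: tailF_nonincreasing => //; lra.
Unshelve. all: by end_near. Qed.

Lemma measurable_weighted_ostat (v : nat -> R) :
  measurable_fun setT (fun w => \sum_(i < n) v i * ostat X (n - i) w).
Proof.
apply: (@measurable_sum _ _ _ _ _ _
  (fun (i : 'I_n) w => v i * ostat X (n - i) w)) => i.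
apply: measurable_funM => //; apply: measurable_ostat => //.
by rewrite subn_gt0 ltn_ord leq_subr.
Qed.

(** The exceptional events [A] and [B] below depend on [D] but not on [v], so one threshold for [x]
    serves all weights. The shift of the maximum and the exceptional event cost [e / 2] each. *)
Lemma weighted_tail (D e : R) : 0 <= D -> 0 < e ->
  \forall x \near +oo, forall v : nat -> R, v 0%N = 1 ->
    (forall i, (1 <= i < n)%N -> 0 <= v i <= D) ->
    (1 - e) * F x
      <= prob P [set w | x < \sum_(i < n) v i * ostat X (n - i) w]
      <= (1 + e) * F x.
Proof.
move=> D0 e0; have e20 : 0 < e / 2 by lra.
have K0 : 0 <= n%:R * D by rewrite mulr_ge0.
have [t t0 tF] := F_shift_scaled _ _ K0 e20.
pose A i j x := [set w | t * h x < `|X i w| /\ x < X j w].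
pose B i j x := [set w | t * h x < X i w /\ X i w <= X j w /\
                         x < X j w + n%:R * D * X i w].
have mXn i : measurable_fun setT (fun w => `|X i w|) by exact: measurableT_comp.
have mXK i j : measurable_fun setT (fun w => X j w + n%:R * D * X i w).
  by apply: measurable_funD => //; exact: measurable_funM.
have mA i j x : measurable (A i j x).
  by apply: measurableI; exact: measurable_set_lt.
have mB i j x : measurable (B i j x).
  apply: measurableI; first exact: measurable_set_lt.
  by apply: measurableI; [exact: measurable_set_le | exact: measurable_set_lt].
have nA := negligible_exists_pair A mA (fun i j ij => joint i j ij t t0) _ e20.
have nB := negligible_exists_pair B mB (fun i j ij => two_large i j ij _ t K0 t0) _ e20.
near=> x => v v0 vD.
have hx : 0 < h x by near: x.
have x0 : 0 < x by near: x; exact: nbhs_pinfty_gt.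
have thx : 0 < t * h x by rewrite mulr_gt0.
have [F1 F2] : F (x - n%:R * D * (t * h x)) <= (1 + e / 2) * F x /\
    (1 - e / 2) * F x <= F (x + n%:R * D * (t * h x)) by near: x.
have Ax : prob P [set w | exists i j, i != j /\ A i j x w] <= e / 2 * F x.
  by near: x.
have Bx : prob P [set w | exists i j, i != j /\ B i j x w] <= e / 2 * F x.
  by near: x.
have mS := measurable_weighted_ostat v.
have mmA := measurable_exists_pair (fun i j => A i j x) (fun i j => mA i j x).
have mmB := measurable_exists_pair (fun i j => B i j x) (fun i j => mB i j x).
have mF y : measurable [set w | y < ostat X n w] by exact: measurable_set_lt.
have mSx : measurable [set w | x < \sum_(i < n) v i * ostat X (n - i) w].
  exact: measurable_set_lt.
apply/andP; split.
- have : F (x + n%:R * D * (t * h x)) <=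
      prob P ([set w | x < \sum_(i < n) v i * ostat X (n - i) w] `|`
              [set w | exists i j, i != j /\ A i j x w]).
    apply: prob_le; [exact: mF | exact: measurableU |].
    move=> w /=; have [j [u [-> Xj uD ->]]] := weighted_ostat_sum X D v w n_gt0 vD.
    move=> xj; have [|noA] := pselect (exists i j, i != j /\ A i j x w).
      by right.
    left; rewrite v0 mul1r.
    (* A very negative [X i w] has a large absolute value while the maximum exceeds [x], which puts
       [w] in [A i j x]. The bound on the weighted sum is then applied to [- X]. *)
    have small i : i != j -> - X i w <= t * h x.
      move=> ij; rewrite leNgt; apply/negP => Xi; apply: noA; exists i, j.
      split=> //; split; first by rewrite (lt_le_trans Xi)// -normrN ler_norm.
      by apply: le_lt_trans xj; rewrite lerDl mulr_ge0// ltW.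
    have := weighted_sum_le j u (fun i => - X i w) D _ D0 (ltW thx) uD small.
    under eq_bigr do rewrite mulrN.
    rewrite sumrN; lra.
  move/le_trans => /(_ _ (prob_setU _ _ _ mSx mmA)).
  have := F_gt0 x; nra.
- have : prob P [set w | x < \sum_(i < n) v i * ostat X (n - i) w] <=
      prob P ([set w | x - n%:R * D * (t * h x) < ostat X n w] `|`
              [set w | exists i j, i != j /\ B i j x w]).
    apply: prob_le => //; first exact: measurableU.
    move=> w /=; have [j [u [-> Xj uD ->]]] := weighted_ostat_sum X D v w n_gt0 vD.
    rewrite v0 mul1r => xS.
    have [small|/existsNP[i0 /not_implyP[i0j /negP]]] :=
      pselect (forall i, i != j -> X i w <= t * h x).
      left; have := weighted_sum_le j u (X ^~ w) D _ D0 (ltW thx) uD small; lra.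
    rewrite -ltNge => Xi0; right.
    (* With the largest non-maximal value [X i w], all the other terms together contribute at most
       [n * D * X i w]; this puts [w] in [B i j x]. *)
    pose i := [arg max_(i > i0 | i != j) X i w]%O.
    have [ij Xi] : i != j /\ forall k, k != j -> X k w <= X i w.
      by rewrite /i; case: Order.TotalTheory.arg_maxP.
    have Xi1 : t * h x < X i w by rewrite (lt_le_trans Xi0)// Xi.
    exists i, j; split=> //; split=> //; split=> //.
    apply: (lt_le_trans xS); rewrite lerD2l.
    by apply: weighted_sum_le => //; rewrite ltW// (lt_trans thx).
  move/le_trans => /(_ _ (prob_setU _ _ _ (mF _) mmB)).
  have := F_gt0 x; rewrite -/(tailF P (ostat X n) _); nra.
Unshelve. all: by end_near. Qed.

(** The event that the maximum exceeds [x] is the union of the events [x < X i w]. For the upper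
    bound, two of these together force [h x <= x < X i w], so their intersection is controlled by
    [joint] with [t = 1]. *)
Lemma max_tail (e : R) : 0 < e ->
  \forall x \near +oo, F x <= \sum_(i < n) prob P [set w | x < X i w]
                            <= (1 + e) * F x.
Proof.
move=> e0.
have nn0 : 0 < (n ^ 2)%:R :> R by rewrite ltr0n expn_gt0 n_gt0.
have : \forall x \near +oo, forall p : 'I_n * 'I_n, p.1 != p.2 ->
    prob P [set w | 1 * h x < `|X p.1 w| /\ x < X p.2 w] <= e / (n ^ 2)%:R * F x.
  apply: filter_forall => -[i j] /=; have [->|ij] := eqVneq i j.
    by near=> x.
  by apply: filterS (joint i j ij _ ltr01 _ (divr_gt0 e0 nn0)) => x.
move=> jx; near=> x.
have mX_gt i : measurable [set w | x < X i w] by exact: measurable_set_lt.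
have hx : h x <= x by near: x.
have FE : F x = prob P (\big[setU/set0]_(i < n) [set w | x < X i w]).
  congr prob; rewrite -bigcup_seq; apply/seteqP.
  split => w /=; have [j [jM Xj]] := ostat_max X w n_gt0; rewrite jM.
    by move=> xM; exists j => //=; rewrite mem_index_enum.
  by move=> [i /= _ xX]; exact: lt_le_trans (Xj i).
apply/andP; split; first by rewrite FE prob_bigsetU.
have eF0 : 0 <= e / (n ^ 2)%:R * F x by rewrite mulr_ge0 ?ltW// divr_gt0.
rewrite mulrDl mul1r {1}FE.
have -> : e * F x = (size (index_enum 'I_n) ^ 2)%:R * (e / (n ^ 2)%:R * F x).
  have -> : size (index_enum 'I_n) = n by rewrite -[RHS]size_enum_ord enumT.
  by rewrite mulrA mulrCA divff ?gt_eqF// mulr1.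
apply: prob_sum_le => //; first exact: index_enum_uniq.
move=> i j ij; apply: (le_trans (y := prob P [set w | 1 * h x < `|X i w| /\ x < X j w])).
  apply: prob_le; first exact: measurableI.
    by apply: measurableI => //; apply: measurable_set_lt => //;
      exact: measurableT_comp.
  move=> w [xi xj]; split=> //; rewrite mul1r.
  exact: (le_lt_trans hx (lt_le_trans xi (ler_norm _))).
have : forall p : 'I_n * 'I_n, p.1 != p.2 ->
    prob P [set w | 1 * h x < `|X p.1 w| /\ x < X p.2 w] <= e / (n ^ 2)%:R * F x.
  by near: x.
by move=> /(_ (i, j)); exact.
Unshelve. all: by end_near. Qed.

End Core.

(** * Negligibility of a second large value *)

Section TwoLarge.
Context {R : realType} {d : measure_display} {T : measurableType d}
  (P : probability T R) {n : nat} (X : 'I_n -> T -> R) (h : R -> R).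
Hypotheses (n_gt0 : (0 < n)%N) (mX : forall i, measurable_fun setT (X i)).
Local Notation F := (tailF P (ostat X n)).
Hypotheses (F_gt0 : forall x, 0 < F x)
  (h_gt0 : \forall x \near +oo, 0 < h x)
  (joint : forall i j, i != j -> forall t : R, 0 < t ->
    negligible_wrt P F (fun x => [set w | t * h x < `|X i w| /\ x < X j w])).

Let mM : measurable_fun setT (ostat X n).
Proof. by apply: measurable_ostat => //; rewrite n_gt0 leqnn. Qed.

Let measurable_joint (i j : 'I_n) (a b : R) :
  measurable [set w | a < `|X i w| /\ b < X j w].
Proof.
by apply: measurableI; apply: measurable_set_lt => //; exact: measurableT_comp.
Qed.

Let measurable_two_large (i j : 'I_n) (K a b : R) :
  measurable [set w | a < X i w /\ X i w <= X j w /\ b < X j w + K * X i w].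
Proof.
apply: measurableI; first exact: measurable_set_lt.
apply: measurableI; first exact: measurable_set_le.
apply: measurable_set_lt => //; apply: measurable_funD => //.
exact: measurable_funM.
Qed.

(** At the point [phi x], [joint] gives a small multiple of [F (phi x)], hence of [F x]. Replacing
    [t] by [t / (|C'| + 1)] compensates for the change from [h (phi x)] to [h x]. *)
Lemma joint_comp (phi : R -> R) (C C' : R) (i j : 'I_n) (t : R) :
  i != j -> 0 < t -> phi x @[x --> +oo] --> +oo ->
  (\forall x \near +oo, F (phi x) <= C * F x) ->
  (\forall x \near +oo, h (phi x) <= C' * h x) ->
  negligible_wrt P F (fun x => [set w | t * h x < `|X i w| /\ phi x < X j w]).
Proof.
move=> ij t0 phiy FC hC e e0.
(* The signs of [C] and [C'] are unknown; these larger constants are positive and can be divided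
   by. *)
have D0 : 0 < `|C| + 1 by rewrite ltr_wpDl.
have D'0 : 0 < `|C'| + 1 by rewrite ltr_wpDl.
near=> x.
have hx : 0 < h x by near: x.
have Fx := F_gt0 x.
have FCx : F (phi x) <= (`|C| + 1) * F x.
  have : F (phi x) <= C * F x by near: x.
  by have := ler_norm C; nra.
have hCx : t / (`|C'| + 1) * h (phi x) <= t * h x.
  have : h (phi x) <= C' * h x by near: x.
  by rewrite mulrAC ler_pdivrMr// -mulrA ler_pM2l//; have := ler_norm C'; nra.
apply: (le_trans (y := e / (`|C| + 1) * F (phi x))); last first.
  by rewrite mulrAC ler_pdivrMr// -mulrA ler_pM2l// mulrC.
apply: (le_trans (y := prob P
    [set w | t / (`|C'| + 1) * h (phi x) < `|X i w| /\ phi x < X j w])).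
  by apply: prob_le => // w /= [? ?]; split=> //; exact: le_lt_trans hCx _.
near: x.
exact: phiy (joint i j ij _ (divr_gt0 t0 D'0) _ (divr_gt0 e0 D0)).
Unshelve. all: by end_near. Qed.

Lemma two_large_shift (L : R) :
  (forall u, exists C, \forall x \near +oo, F (x + u * h x) <= C * F x) ->
  (forall u, exists C, \forall x \near +oo, h (x + u * h x) <= C * h x) ->
  (forall i j, i != j ->
    negligible_wrt P F (fun x => [set w | L * h x < X i w /\ L * h x < X j w])) ->
  forall i j, i != j -> forall K t : R, 0 <= K -> 0 < t ->
    negligible_wrt P F (fun x =>
      [set w | t * h x < X i w /\ X i w <= X j w /\ x < X j w + K * X i w]).
Proof.
move=> FC hC big i j ij K t K0 t0 e e0.
have [C FCu] := FC (- (K * L)); have [C' hCu] := hC (- (K * L)).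
have phiy : x + - (K * L) * h x @[x --> +oo] --> +oo.
  apply: shift_cvgy FCu => //; last exact: tailF_near0.
  by move=> x y; exact: tailF_nonincreasing.
have e20 : 0 < e / 2 by lra.
have jn := joint_comp _ _ _ _ _ _ ij t0 phiy FCu hCu _ e20.
have bn := big i j ij _ e20.
near=> x.
have bx : prob P [set w | L * h x < X i w /\ L * h x < X j w] <= e / 2 * F x.
  by near: x.
have jx : prob P [set w | t * h x < `|X i w| /\ x + - (K * L) * h x < X j w]
    <= e / 2 * F x by near: x.
have mb : measurable [set w | L * h x < X i w /\ L * h x < X j w].
  by apply: measurableI; exact: measurable_set_lt.
rewrite (le_trans (y := prob P (
    [set w | L * h x < X i w /\ L * h x < X j w] `|`
    [set w | t * h x < `|X i w| /\ x + - (K * L) * h x < X j w])))//.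
  apply: prob_le => //; first exact: measurableU.
  (* If [X i w] exceeds [L * h x], so does the larger [X j w]; otherwise [K * X i w] is at most
     [K * L * h x], which lowers the level for [X j w] by that amount. *)
  move=> w /= [ti [ij' xK]]; have [Li|Li] := ltP (L * h x) (X i w).
    by left; split=> //; exact: lt_le_trans ij'.
  right; split; first exact: lt_le_trans (ler_norm _).
  by have := ler_wpM2l K0 Li; lra.
apply: (le_trans (prob_setU _ _ _ mb (measurable_joint _ _ _ _))).
by have := F_gt0 x; lra.
Unshelve. all: by end_near. Qed.

(** From [X i w <= X j w] and [x < X j w + K * X i w] follows [x / (K + 1) < X j w]. Dominated
    variation at the factor [1 / (K + 1)] provides the two constants for [joint_comp]. *)
Lemma two_large_dom : dom_varying F -> dom_varying h ->
  forall i j, i != j -> forall K t : R, 0 <= K -> 0 < t ->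
    negligible_wrt P F (fun x =>
      [set w | t * h x < X i w /\ X i w <= X j w /\ x < X j w + K * X i w]).
Proof.
move=> FD hD i j ij K t K0 t0 e e0.
have K1 : 0 < K + 1 by rewrite ltr_wpDl.
have y0 : 0 < (K + 1)^-1 by rewrite invr_gt0.
have [c [C [_ FC]]] := FD _ y0; have [c' [C' [_ hC]]] := hD _ y0.
have phiy : x * (K + 1)^-1 @[x --> +oo] --> +oo.
  apply/cvgryPge => A; apply: filterS (nbhs_pinfty_ge (num_real (A * (K + 1)))) => x.
  by rewrite ler_pdivlMr.
have FC1 : \forall x \near +oo, F (x * (K + 1)^-1) <= C * F x.
  by apply: filterS FC => x /andP[_]; rewrite ler_pdivrMr.
have hC1 : \forall x \near +oo, h (x * (K + 1)^-1) <= C' * h x.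
  by apply: filterS2 h_gt0 hC => x hx /andP[_]; rewrite ler_pdivrMr.
apply: filterS (joint_comp _ _ _ _ _ _ ij t0 phiy FC1 hC1 _ e0) => x.
apply: le_trans; apply: prob_le => // w /= [ti [ij' xK]].
split; first exact: lt_le_trans (ler_norm _).
by rewrite ltr_pdivrMr//; nra.
Qed.

End TwoLarge.

(** * From one level to ratios that are uniform in the weights *)

Lemma symmetric_pairs {n : nat} (Q : 'I_n -> 'I_n -> Prop) :
  (forall i j, Q i j -> Q j i) -> (forall i j : 'I_n, (i < j)%N -> Q i j) ->
  forall i j, i != j -> Q i j.
Proof.
move=> sQ ltQ i j; rewrite -val_eqE neq_ltn => /orP[|]; first exact: ltQ.
by move=> ji; apply: sQ; exact: ltQ.
Qed.

(** The factor 2 comes from the quotient of [S] by [Tt], as [(1 - e) / (1 + e) >= 1 - 2 * e]. The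
    bound [e <= 1 / 2] keeps [1 - 2 * e] nonnegative, so that it can multiply the upper bound on
    [Tt]. *)
Lemma ratios_near1 {R : realType} (e F S Tt : R) :
  0 < F -> 0 <= S -> 0 < e -> e <= 1 / 2 ->
  (1 - e) * F <= S <= (1 + e) * F -> F <= Tt <= (1 + e) * F ->
  `|S / F - 1| <= 2 * e /\ `|F / Tt - 1| <= 2 * e /\ `|S / Tt - 1| <= 2 * e.
Proof.
move=> F0 S0 e0 e1 /andP[S1 S2] /andP[T1 T2].
have T0 : 0 < Tt by exact: lt_le_trans T1.
rewrite !ler_distl !ler_pdivlMr// !ler_pdivrMr//.
split; first by apply/andP; split; nra.
split; first by apply/andP; split; nra.
apply/andP; split; last by nra.
have : (1 - 2 * e) * Tt <= (1 - 2 * e) * ((1 + e) * F) by rewrite ler_wpM2l//; lra.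
nra.
Qed.

(** Source of the uniformity in [c 0]: once [x > b * |A|], every [x / c] with [0 < c <= b] is beyond
    the threshold [A], whatever the sign of [A]. *)
Lemma near_pinfty_div {R : realType} (b : R) (Q : R -> Prop) : 0 < b ->
  (\forall x \near +oo, Q x) ->
  \forall x \near +oo, forall c : R, 0 < c <= b -> Q (x / c).
Proof.
move=> b0 [A [_ QA]].
apply: filterS (nbhs_pinfty_gt (num_real (b * `|A|))) => x xA c /andP[c0 cb].
apply: QA; rewrite ltr_pdivlMr//.
by have := ler_norm A; have := normr_ge0 A; nra.
Qed.

Section Uniform.
Context {R : realType} {d : measure_display} {T : measurableType d}
  (P : probability T R) {n : nat} (X : 'I_n -> T -> R) (h : R -> R).
Hypotheses (n_gt0 : (0 < n)%N) (mX : forall i, measurable_fun setT (X i)).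
Local Notation F := (tailF P (ostat X n)).
Hypotheses (F_gt0 : forall x, 0 < F x)
  (h_gt0 : \forall x \near +oo, 0 < h x)
  (* [phi y] is [exp (- y)] in case (A) and [1] in cases (B) and (C). *)
  (phi : R -> R) (phi0 : phi t @[t --> 0] --> (1 : R))
  (F_phi : forall y : R, (fun x => F (x + y * h x) / F x) @ +oo --> phi y)
  (joint : forall i j, i != j -> forall t : R, 0 < t ->
    negligible_wrt P F (fun x => [set w | t * h x < `|X i w| /\ x < X j w]))
  (two_large : forall i j, i != j -> forall K t : R, 0 <= K -> 0 < t ->
    negligible_wrt P F (fun x =>
      [set w | t * h x < X i w /\ X i w <= X j w /\ x < X j w + K * X i w])).

Lemma ratio_bounded (u : R) :
  exists C, \forall x \near +oo, F (x + u * h x) <= C * F x.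
Proof.
by exists (phi u + 1); apply: near_ratio_le => //; rewrite ltrDl.
Qed.

(** By continuity of [phi] at 0 with value 1, a small [t] satisfies both [phi t > 1 - e] and
    [phi (- t) < 1 + e]; both limits then pass to [F]. *)
Lemma F_shift (e : R) : 0 < e -> exists2 t : R, 0 < t &
  \forall x \near +oo, F (x - t * h x) <= (1 + e) * F x /\
                       (1 - e) * F x <= F (x + t * h x).
Proof.
move=> e0.
have /nbhs_ballP[r /= r0 br] : \forall t \near (0 : R), phi t < 1 + e /\ 1 - e < phi t.
  near=> t; split; near: t.
    by apply: cvgr_lt phi0 _ _; rewrite ltrDl.
  by apply: cvgr_gt phi0 _ _; rewrite gtrBl.
have r2 : 0 < r / 2 by lra.
have [|_ p1] := br (r / 2); first by rewrite /ball/= sub0r normrN gtr0_norm//; lra.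
have [|p2 _] := br (- (r / 2)).
  by rewrite /ball/= sub0r opprK gtr0_norm//; lra.
exists (r / 2) => //.
have n1 := near_ratio_ge _ _ _ _ F_gt0 (F_phi (r / 2)) p1.
have n2 := near_ratio_le _ _ _ _ F_gt0 (F_phi (- (r / 2))) p2.
by apply: filterS2 n1 n2 => x ? ?; rewrite -mulNr.
Unshelve. all: by end_near. Qed.

(** Case (A) states no growth bound on [h]. However, [F (x - h x)] is at most a multiple of [F x],
    which forces [x - h x] to tend to infinity. *)
Lemma scale_le_id : \forall x \near +oo, h x <= x.
Proof.
have mM : measurable_fun setT (ostat X n).
  by apply: measurable_ostat => //; rewrite n_gt0 leqnn.
have [C FC] := ratio_bounded (- 1).
have /cvgryPge/(_ 0) : x + - 1 * h x @[x --> +oo] --> +oo.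
  apply: shift_cvgy FC => //; last exact: tailF_near0.
  by move=> x y; exact: tailF_nonincreasing.
by apply: filterS => x; rewrite mulN1r subr_ge0.
Qed.

Lemma uniform_tail (a b dd : R) : 0 < a -> a <= b -> 0 <= dd ->
  let S (c : nat -> R) (x : R) :=
    prob P [set w | x < \sum_(i < n) c i * ostat X (n - i) w] in
  let M (c : nat -> R) (x : R) := prob P [set w | x < c 0%N * ostat X n w] in
  let Tt (c : nat -> R) (x : R) :=
    \sum_(i < n) prob P [set w | x < c 0%N * X i w] in
  forall eps : R, 0 < eps ->
  \forall x \near +oo, forall c : nat -> R,
    a <= c 0%N <= b -> (forall i : nat, (1 <= i < n)%N -> 0 <= c i <= dd) ->
    `|S c x / M c x - 1| <= eps /\ `|M c x / Tt c x - 1| <= eps /\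
    `|S c x / Tt c x - 1| <= eps.
Proof.
move=> a0 ab dd0 S M Tt eps eps0.
(* [eps / 2] pays for the factor 2 in [ratios_near1], and [1 / 2] meets its assumption on [e]. *)
pose e := Num.min (eps / 2) (1 / 2).
have e0 : 0 < e by rewrite lt_min; apply/andP; split; lra.
have e1 : e <= 1 / 2 by rewrite ge_min lexx orbT.
have e2 : 2 * e <= eps.
  by have : e <= eps / 2 by [rewrite ge_min lexx]; lra.
have D0 : 0 <= dd / a by rewrite divr_ge0// ltW.
have nS := weighted_tail P X h n_gt0 mX F_gt0 h_gt0 F_shift joint two_large _ _ D0 e0.
have nT := max_tail P X h n_gt0 mX F_gt0 scale_le_id joint _ e0.
have b0 : 0 < b by exact: lt_le_trans ab.
apply: filterS (near_pinfty_div _ _ b0 (filterI nS nT)) => x near_x c /andP[ac cb] cdd.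
have c0 : 0 < c 0%N by exact: lt_le_trans ac.
have [|Sx Tx] := near_x (c 0%N); first by rewrite c0.
have SE : S c x = prob P
    [set w | x / c 0%N < \sum_(i < n) c i / c 0%N * ostat X (n - i) w].
  have sE w : \sum_(i < n) c i / c 0%N * ostat X (n - i) w
      = (\sum_(i < n) c i * ostat X (n - i) w) / c 0%N.
    by rewrite mulr_suml; apply: eq_bigr => i _; rewrite mulrAC.
  congr prob; apply/seteqP; split => w /=;
    by rewrite sE ltr_pM2r ?invr_gt0.
have ME : M c x = F (x / c 0%N).
  by congr prob; apply/seteqP; split => w /=; rewrite ltr_pdivrMr// mulrC.
have TE : Tt c x = \sum_(i < n) prob P [set w | x / c 0%N < X i w].
  apply: eq_bigr => i _.
  by congr prob; apply/seteqP; split => w /=; rewrite ltr_pdivrMr// mulrC.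
have [] := ratios_near1 e (M c x) (S c x) (Tt c x) _ _ e0 e1 _ _.
- by rewrite ME.
- exact: prob_ge0.
- rewrite ME SE; apply: (Sx (fun i => c i / c 0%N)); first by rewrite divff ?gt_eqF.
  move=> i /cdd/andP[ci0 cid]; rewrite divr_ge0 ?(ltW c0)//=.
  by rewrite ler_pM ?invr_ge0 ?(ltW c0)// lef_pV2 ?posrE.
- by rewrite ME TE.
move=> h1 [h2 h3]; split; first exact: le_trans e2.
by split; exact: le_trans e2.
Qed.

End Uniform.

(** * The three sets of assumptions *)

Theorem theorem3p1 (R : realType) (d : measure_display) (T : measurableType d)
  (P : probability T R) (n : nat) (hn : (2 <= n)%N)
  (X : 'I_n -> T -> R) (hX : forall i, measurable_fun setT (X i)) :
  let Mx := ostat X n in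
  let Fbar := tailF P Mx in
  let star h := forall (i j : 'I_n), i != j -> forall t : R, 0 < t ->
      (fun x => prob P [set w | t * h x < `|X i w| /\ x < X j w] / Fbar x)
        @ +oo --> (0:R) in
  let star2 h := exists L : R, 0 < L /\ forall (i j : 'I_n), (i < j)%N ->
      (fun x => prob P [set w | L * h x < X i w /\ L * h x < X j w] / Fbar x)
        @ +oo --> (0:R) in
  ( (exists h : R -> R, (forall x, 0 < h x) /\ GMDA_inf Fbar h /\ star h /\ star2 h)
    \/ (long_tailed Fbar /\ exists h : R -> R, HF Fbar h /\ star h /\ star2 h)
    \/ (long_tailed Fbar /\ dom_varying Fbar /\
        exists h : R -> R, dom_varying h /\ HF Fbar h /\ star h) ) ->
  forall a b dd : R, 0 < a -> a <= b -> 0 <= dd ->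
  let S (c : nat -> R) (x : R) := prob P [set w | x < \sum_(i < n) c i * ostat X (n - i) w] in
  let M (c : nat -> R) (x : R) := prob P [set w | x < c 0%N * Mx w] in
  let Tt (c : nat -> R) (x : R) := \sum_(i < n) prob P [set w | x < c 0%N * X i w] in
  forall eps : R, 0 < eps ->
  \forall x \near +oo, forall c : nat -> R,
    a <= c 0%N <= b -> (forall i : nat, (1 <= i < n)%N -> 0 <= c i <= dd) ->
    `|S c x / M c x - 1| <= eps /\ `|M c x / Tt c x - 1| <= eps /\
    `|S c x / Tt c x - 1| <= eps.
Proof.
move=> Mx Fbar star star2 cases a b dd.
have n_gt0 : (0 < n)%N by exact: ltnW.
have mM : measurable_fun setT Mx.
  by apply: measurable_ostat => //; rewrite n_gt0 leqnn.
have F_mono x y : x <= y -> Fbar y <= Fbar x by exact: tailF_nonincreasing.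
have F_near0 : forall e, 0 < e -> \forall x \near +oo, Fbar x <= e.
  by move=> e; exact: tailF_near0.
(* Long-tailedness gives positivity on [x >= 0]; monotonicity extends it to negative [x]. *)
have long_gt0 : long_tailed Fbar -> forall x, 0 < Fbar x.
  move=> [F0 _] x; have [x0|x0] := leP 0 x; first exact: F0.
  by rewrite (lt_le_trans (F0 0 (lexx 0)))// F_mono// ltW.
have joint_of h : (forall x, 0 < Fbar x) -> star h ->
    forall i j, i != j -> forall t : R, 0 < t ->
    negligible_wrt P Fbar (fun x => [set w | t * h x < `|X i w| /\ x < X j w]).
  by move=> F0 st i j ij t t0 e; exact: near_ratio_le F0 (st i j ij t t0).
have two_large_of h (phi : R -> R) : (forall x, 0 < Fbar x) ->
    (\forall x \near +oo, 0 < h x) ->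
    (forall y, (fun x => Fbar (x + y * h x) / Fbar x) @ +oo --> phi y) ->
    (forall u, exists C, \forall x \near +oo, h (x + u * h x) <= C * h x) ->
    star h -> star2 h ->
    forall i j, i != j -> forall K t : R, 0 <= K -> 0 < t ->
      negligible_wrt P Fbar (fun x =>
        [set w | t * h x < X i w /\ X i w <= X j w /\ x < X j w + K * X i w]).
  move=> F0 h0 Fphi hC st [L [L0 st2]].
  apply: (two_large_shift P X h n_gt0 hX F0 h0 (joint_of h F0 st) L) => //.
    exact: (ratio_bounded P X h F0 phi Fphi).
  (* The assumption on two large values concerns [i < j], but the event is symmetric in [i] and
     [j]. *)
  apply: symmetric_pairs => [i j Aij e e0|i j ij e].
    apply: filterS (Aij e e0) => x; congr (prob P _ <= _).
    by apply/seteqP; split => w [].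
  exact: near_ratio_le F0 (st2 i j ij).
have cvg_cst1 : (fun _ : R => 1 : R) t @[t --> 0] --> (1 : R) by exact: cvg_cst.
case: cases => [[h [h0 [G [st st2]]]]|[[LT [h [[h0 [_ [Fh hC]]] [st st2]]]]|
    [LT [FD [h [hD [[h0 [_ [Fh _]]] st]]]]]]].
(* Case (A): the limit function is [expR (- y)], and [GMDA_scale_le] supplies the control of [h] at
   shifted points. *)
- have F0 := G.1.
  have h0' : \forall x \near +oo, 0 < h x by near=> x.
  have exp0 : expR (- t) @[t --> 0] --> (1 : R).
    have expN : continuous (fun t : R => expR (- t)).
      move=> t; apply: continuous_comp; first exact: opp_continuous.
      exact: continuous_expR.
    by have := expN 0; rewrite /continuous_at oppr0 expR0.
  apply: (uniform_tail P X h n_gt0 hX F0 h0' _ exp0 G.2 (joint_of h F0 st)).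
  apply: (two_large_of h _ F0 h0' G.2) => // u; exists 2.
  exact: (GMDA_scale_le Fbar h F0 F_mono F_near0 u h0 G).
(* Case (B): the limit function is 1, and the control of [h] is clause (iii) of the class,
   multiplied by [h x]. *)
- have F0 := long_gt0 LT.
  apply: (uniform_tail P X h n_gt0 hX F0 h0 _ cvg_cst1 Fh (joint_of h F0 st)).
  apply: (two_large_of h _ F0 h0 Fh) => // u.
  have [C hCu] := hC u; exists C; apply: filterS2 h0 hCu => x hx.
  by rewrite ler_pdivrMr.
(* Case (C): the limit function is again 1, and dominated variation replaces the assumption on two
   large values. *)
- have F0 := long_gt0 LT.
  apply: (uniform_tail P X h n_gt0 hX F0 h0 _ cvg_cst1 Fh (joint_of h F0 st)).
  exact: two_large_dom (joint_of h F0 st) FD hD.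
Unshelve. all: by end_near. Qed.
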